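(* Let $G$ be an infinite, connected, simple, undirected graph with all degrees finite, and fix a rotor mechanism on $G$. If two rotor configurations on $G$ differ only at finitely many vertices, then they are either both recurrent or both transient.
   Context: A rotor mechanism on $G$ assigns to each vertex a fixed cyclic order of its neighbours (a single cycle through all neighbours). A rotor configuration assigns to each vertex one of its neighbours (the vertex its rotor points to). Given a rotor mechanism, an initial rotor configuration and a starting vertex for a particle, the rotor walk evolves in discrete time: at each step the rotor at the particle's current location is first incremented to point to the next neighbour in the cyclic order, and then the particle moves to this new neighbour. On such a graph, the rotor walk either visits every vertex infinitely many times (the walk is recurrent) or visits every vertex only finitely many times (the walk is transient). A rotor configuration is called recurrent (respectively transient) if the rotor walk with it as initial configuration is recurrent (respectively transient) for every starting vertex; for a fixed mechanism, every rotor configuration is one or the other, since whether the walk is recurrent or transient does not depend on the starting vertex. *)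

(* Defs.v *)
From mathcomp Require Import all_boot all_order.
From mathcomp Require Import classical_sets cardinality.

Set Implicit Arguments.
Unset Strict Implicit.
Unset Printing Implicit Defensive.

Local Open Scope classical_set_scope.

(* A simple undirected graph with vertex type V is given by a symmetric,
   irreflexive adjacency relation e : rel V. *)
Definition graph_connected (V : eqType) (e : rel V) : Prop :=
  forall u v : V, exists p : seq V, path e u p /\ last u p = v.

Definition locally_finite (V : eqType) (e : rel V) : Prop :=
  forall v : V, finite_set [set u | e v u].

(* The cyclic order of the neighbours of v is encoded by a duplicate-free
   sequence m v listing them, read cyclically: the successor of u is
   next (m v) u, which wraps around at the end. *)
Definition rotor_mechanism (V : eqType) (e : rel V) (m : V -> seq V) : Prop :=
  forall v : V, uniq (m v) /\ (forall u : V, (u \in m v) = e v u).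

Definition rotor_configuration (V : eqType) (e : rel V) (rho : V -> V) : Prop :=
  forall v : V, e v (rho v).

(* A state is a pair of the current rotor configuration and the particle's
   position. *)
Definition rotor_step (V : eqType) (m : V -> seq V) (s : (V -> V) * V) :
    (V -> V) * V :=
  let: (rho, x) := s in
  let y := next (m x) (rho x) in
  (fun v : V => if v == x then y else rho v, y).

Definition rotor_walk (V : eqType) (m : V -> seq V) (rho : V -> V) (x0 : V)
    (t : nat) : V :=
  (iter t (rotor_step m) (rho, x0)).2.

Definition visit_times (V : eqType) (m : V -> seq V) (rho : V -> V) (x0 v : V) :
    set nat :=
  [set t | rotor_walk m rho x0 t = v].

Definition recurrent_walk (V : eqType) (m : V -> seq V) (rho : V -> V)
    (x0 : V) : Prop :=
  forall v : V, infinite_set (visit_times m rho x0 v).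

Definition transient_walk (V : eqType) (m : V -> seq V) (rho : V -> V)
    (x0 : V) : Prop :=
  forall v : V, finite_set (visit_times m rho x0 v).

Definition recurrent_configuration (V : eqType) (m : V -> seq V)
    (rho : V -> V) : Prop :=
  forall x0 : V, recurrent_walk m rho x0.

Definition transient_configuration (V : eqType) (m : V -> seq V)
    (rho : V -> V) : Prop :=
  forall x0 : V, transient_walk m rho x0.

(* Main.v *)
(* By abelianness, the walk from x is transient iff some finite function u on
   the vertices satisfies u >= [x] + inflow_u, where inflow_u v counts the
   moves into v when each vertex w is fired u w times: such a u bounds the
   odometer of the walk, and the odometer of a transient walk is one.
   Given such a u for rho and x, changing rho on a finite set and moving the
   start to y turns it into a solution for finitely many chips and no more
   holes than chips other than the one at y.  A hole performs a rotor walk: it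
   can be moved along this walk by adding the walk's odometer to u.  If the
   walk is recurrent the hole meets a chip and both cancel; if it is transient
   the hole escapes to infinity.  Once all holes are gone, u certifies that the
   walk from y is transient. *)
Require Import Defs.
From mathcomp Require Import all_boot all_order.
From mathcomp Require Import classical_sets cardinality.
From mathcomp Require Import boolp zify.

(** * Full turns of a cyclic order *)

(** Rotated to start at [x], the cycle [s] is a path of [next s] from [x] back to [x]. *)
Lemma traject_next_uniq (T : eqType) (s : seq T) (x : T) :
  uniq s -> x \in s ->
  perm_eq (traject (next s) (next s x) (size s)) s /\
  iter (size s) (next s) x = x.
Proof.
move=> Us xs; have [i s' def_s] := rot_to xs.
have /fpathP[n def_n] : fpath (next s) x (rcons s' x).
  have := cycle_next (p := rot i s); rewrite rot_uniq => /(_ Us).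
  rewrite (eq_cycle (e' := frel (next s))) => [|y z /=]; last by rewrite next_rot.
  by rewrite def_s.
have sz : n = size s.
  have := congr1 size def_n; rewrite size_traject size_rcons => <-.
  by rewrite -(size_rot i s) def_s.
rewrite -sz -def_n; split.
  by rewrite perm_rcons -def_s perm_rot.
have := last_rcons x s' x; rewrite def_n => {def_n sz}.
by case: n => [|n] //; rewrite trajectSr last_rcons -iterSr.
Qed.

Lemma count_traject_next_ge (T : eqType) (s : seq T) (x y : T) (n : nat) :
  uniq s -> x \in s -> y \in s ->
  n <= count_mem y (traject (next s) (next s x) (size s * n)).
Proof.
move=> Us xs ys; have [pe it] := traject_next_uniq T s x Us xs.
elim: n => // n IHn; rewrite mulnS trajectD count_cat -iterSr iterS it.
by rewrite (permP pe) count_uniq_mem // ys; lia.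
Qed.

(** * Exits, inflow and the odometer *)

Section RotorWalk.

Variables (V : eqType) (e : rel V) (m : V -> seq V).
Hypotheses (e_sym : symmetric e) (m_mech : rotor_mechanism e m).

Let mem_m u v : (u \in m v) = e v u. Proof. by case: (m_mech v). Qed.
Let uniq_m v : uniq (m v). Proof. by case: (m_mech v). Qed.

(** The rotor is incremented before each move, so the first target is the successor of [rho w]. *)
Definition exits (rho : V -> V) (w : V) (n : nat) : seq V :=
  traject (next (m w)) (next (m w) (rho w)) n.

Definition rotate (rho : V -> V) (u : V -> nat) (w : V) : V :=
  iter (u w) (next (m w)) (rho w).

(** A finite sum over [m v] suffices: by symmetry of adjacency only neighbours of [v] send anything
    to [v]. *)
Definition inflow (rho : V -> V) (u : V -> nat) (v : V) : nat :=
  \sum_(w <- m v) count_mem v (exits rho w (u w)).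

(** Time [t] itself is excluded, so this counts departures from [v]. *)
Definition odometer (rho : V -> V) (x : V) (t : nat) (v : V) : nat :=
  \sum_(s < t) (rotor_walk m rho x s == v).

Lemma rotor_configuration_rotate rho u :
  rotor_configuration e rho -> rotor_configuration e (rotate rho u).
Proof.
move=> rho_conf w; rewrite -mem_m /rotate.
by elim: (u w) => [|n IHn] /=; rewrite ?mem_next // mem_m.
Qed.

Lemma exitsD rho u w n :
  exits rho w (u w + n) = exits rho w (u w) ++ exits (rotate rho u) w n.
Proof. by rewrite /exits trajectD -iterSr iterS. Qed.

Lemma exits_nonadjacent rho w n v :
  rotor_configuration e rho -> w \notin m v -> count_mem v (exits rho w n) = 0.
Proof.
move=> rho_conf wv; apply/count_memPn/negP => /trajectP[k _ vE].
move: wv; rewrite mem_m e_sym -mem_m vE -iterSr.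
by elim: k.+1 => [|j IHj] /=; rewrite ?mem_next // mem_m rho_conf.
Qed.

Lemma inflowD rho u h v :
  inflow rho (fun w => u w + h w) v = inflow rho u v + inflow (rotate rho u) h v.
Proof. by rewrite /inflow -big_split; apply: eq_bigr => w _; rewrite exitsD count_cat. Qed.

Lemma eq_inflow rho u h v :
  {in m v, u =1 h} -> inflow rho u v = inflow rho h v.
Proof. by move=> uh; apply: eq_big_seq => w /uh ->. Qed.

Lemma leq_inflow rho u h v :
  (forall w, u w <= h w) -> inflow rho u v <= inflow rho h v.
Proof.
move=> uh; apply: leq_sum => w _.
by rewrite -(subnKC (uh w)) exitsD count_cat leq_addr.
Qed.

Lemma odometerS rho x t v :
  odometer rho x t.+1 v = odometer rho x t v + (rotor_walk m rho x t == v).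
Proof. by rewrite /odometer big_ord_recr. Qed.

Lemma leq_odometer rho x s t v :
  s <= t -> odometer rho x s v <= odometer rho x t v.
Proof.
move=> /subnKC <-; elim: (t - s) => [|n IHn]; first by rewrite addn0.
by rewrite addnS odometerS (leq_trans IHn) ?leq_addr.
Qed.

Lemma iter_rotor_step_config rho x t w :
  (iter t (rotor_step m) (rho, x)).1 w = rotate rho (odometer rho x t) w.
Proof.
elim: t => [|t IHt]; first by rewrite /rotate /odometer big_ord0.
rewrite iterS /rotate odometerS /rotor_walk.
case: (iter t _ _) IHt => sigma y /= IHt; rewrite [w == y]eq_sym.
by case: eqP => [->|_]; rewrite ?addn1 ?addn0 /= IHt.
Qed.

Lemma rotor_walkS rho x t (y := rotor_walk m rho x t) :
  rotor_walk m rho x t.+1 = next (m y) (rotate rho (odometer rho x t) y).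
Proof.
rewrite -iter_rotor_step_config {}/y /rotor_walk iterS.
by case: (iter t _ _).
Qed.

Lemma inflow_odometerS rho x t v :
  rotor_configuration e rho ->
  inflow rho (odometer rho x t.+1) v =
  inflow rho (odometer rho x t) v + (rotor_walk m rho x t.+1 == v).
Proof.
move=> rho_conf; set y := rotor_walk m rho x t.
have yS : inflow rho (odometer rho x t.+1) v =
    inflow rho (fun w => odometer rho x t w + (w == y)) v.
  by apply: eq_inflow => w _; rewrite odometerS eq_sym.
rewrite yS inflowD; congr addn; set sigma := rotate _ _.
have sigma_conf : rotor_configuration e sigma by exact: rotor_configuration_rotate.
rewrite rotor_walkS -/y -/sigma /inflow.
have exits1 : count_mem v (exits sigma y 1) = (next (m y) (sigma y) == v).
  by rewrite /= addn0.
have [ymv|ymv] := boolP (y \in m v).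
  rewrite (bigD1_seq y) //= eqxx exits1 big1_seq ?addn0 // => w /andP[/negPf-> _].
  by [].
(* Here the sum has no term for [y], and the new exit from [y] is not [v] either. *)
rewrite -exits1 exits_nonadjacent // big1_seq // => w /andP[_ wmv].
by case: eqP => // wy; rewrite -wy wmv in ymv.
Qed.

(** Conservation of the particle: departures and presence match start and arrivals. *)
Lemma odometer_balance rho x t v :
  rotor_configuration e rho ->
  odometer rho x t v + (rotor_walk m rho x t == v) =
  (x == v) + inflow rho (odometer rho x t) v.
Proof.
move=> rho_conf; elim: t => [|t IHt].
  rewrite /odometer big_ord0 /inflow big1 ?addn0 // => w _.
  by rewrite big_ord0.
by rewrite inflow_odometerS // odometerS IHt addnA.
Qed.

(** * Finitely many visits and the dichotomy *)

Definition eventually_avoids rho x v :=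
  exists T, forall t, T <= t -> rotor_walk m rho x t <> v.

Lemma finite_visit_timesP rho x v :
  finite_set (visit_times m rho x v) <-> eventually_avoids rho x v.
Proof.
split=> [/finite_seqP[s visits]|[T avoid]].
  exists (\max_(i <- s) i).+1 => t tT tv.
  have : t \in s.
    by have : [set` s]%classic t by rewrite -visits.
  move=> ts; have := leq_bigmax_seq (P := xpredT) (F := id) t ts isT.
  by rewrite leqNgt tT.
apply: (sub_finite_set _ (finite_II T)) => t /= tv.
by rewrite ltnNge; apply/negP => /avoid.
Qed.

Lemma odometer_stationary rho x v T t :
  (forall t, T <= t -> rotor_walk m rho x t <> v) -> T <= t ->
  odometer rho x t v = odometer rho x T v.
Proof.
move=> avoid /subnKC <-; elim: (t - T) => [|n IHn]; first by rewrite addn0.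
rewrite addnS odometerS IHn; case: eqP => [/avoid//|_]; last by rewrite addn0.
by rewrite leq_addr => /(_ isT).
Qed.

Lemma eventually_avoidsP rho x v :
  eventually_avoids rho x v <-> exists n, forall t, odometer rho x t v <= n.
Proof.
split=> [[T avoid]|[n bound]].
  exists (odometer rho x T v) => t; have [tT|/ltnW Tt] := leqP t T.
    exact: leq_odometer.
  by rewrite (odometer_stationary _ _ _ _ _ avoid Tt).
apply: contrapT => unavoid.
have [t] : exists t, n < odometer rho x t v.
  elim: n.+1 => [|k [t IHk]]; first by exists 0.
  have [s [ts sv]] : exists s, t <= s /\ rotor_walk m rho x s = v.
    apply: contrapT => none; apply: unavoid; exists t => s ts sv.
    by apply: none; exists s.
  exists s.+1; rewrite odometerS sv eqxx addn1 ltnS.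
  exact: leq_trans (leq_odometer _ _ _ _ _ ts).
by rewrite ltnNge bound.
Qed.

Lemma eventually_avoids_adjacent rho x v w :
  rotor_configuration e rho -> e v w ->
  eventually_avoids rho x w -> eventually_avoids rho x v.
Proof.
move=> rho_conf vw /eventually_avoidsP[n bound]; apply/eventually_avoidsP.
(* This many departures are [n.+2] full turns, hence [n.+2] arrivals at [w]; at most [n] departures
   and one current stay can account for them. *)
exists (size (m v) * n.+2) => t; rewrite leqNgt; apply/negP => /ltnW many.
have := odometer_balance rho x t w rho_conf.
have : n.+2 <= inflow rho (odometer rho x t) w.
  have vmw : v \in m w by rewrite mem_m e_sym.
  apply: (@leq_trans (count_mem w (exits rho v (odometer rho x t v)))).
    rewrite -(subnKC many) /exits trajectD count_cat.
    apply: leq_trans (leq_addr _ _).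
    by apply: count_traject_next_ge; rewrite ?mem_m.
  by rewrite /inflow (bigD1_seq v) //= leq_addr.
by have := bound t; case: (_ == w); lia.
Qed.

Lemma recurrent_or_transient_walk rho x :
  graph_connected e -> rotor_configuration e rho ->
  recurrent_walk m rho x \/ transient_walk m rho x.
Proof.
move=> e_conn rho_conf.
have [rec|/existsNP[v /contrapT/finite_visit_timesP avoid]] := EM (recurrent_walk m rho x).
  by left.
right=> u; apply/finite_visit_timesP; have [p [up vE]] := e_conn u v.
elim: p u up vE => [|w p IHp] u /=; first by move=> _ ->.
case/andP=> uw wp vE; exact: eventually_avoids_adjacent uw (IHp w wp vE).
Qed.

(** * Chips, holes and their cancellation *)

(* [u] is a candidate odometer for chips initially at [A] and holes initially
   at [B]. *)
Definition absorbs rho (u : V -> nat) (A B : seq V) :=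
  forall v, count_mem v A + inflow rho u v <= u v + count_mem v B.

(** Since inflow is monotone, the balance shows by induction on time that the odometer never exceeds
    [u]. *)
Lemma absorbs_transient rho u x :
  rotor_configuration e rho -> absorbs rho u [:: x] [::] ->
  transient_walk m rho x.
Proof.
move=> rho_conf abs v; apply/finite_visit_timesP/eventually_avoidsP.
exists (u v) => t; elim: t v => [|t IHt] v; first by rewrite /odometer big_ord0.
rewrite odometerS odometer_balance //.
have := abs v; have := leq_inflow rho _ _ v IHt.
by rewrite /= !addn0; lia.
Qed.

Lemma absorbs_move rho u A B b t :
  rotor_configuration e rho -> absorbs rho u A (b :: B) ->
  absorbs rho (fun v => u v + odometer (rotate rho u) b t v) A
    (rotor_walk m (rotate rho u) b t :: B).
Proof.
move=> rho_conf abs v; rewrite inflowD.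
have := odometer_balance _ b t v (rotor_configuration_rotate rho u rho_conf).
by have := abs v; rewrite /=; lia.
Qed.

(** The total odometer of the hole's walk is added to [u]. The inequality at [v] involves only [v]
    and its finitely many neighbours, so it can be checked at a time after all visits to them. *)
Lemma absorbs_escape rho u A B b :
  rotor_configuration e rho -> transient_walk m (rotate rho u) b ->
  absorbs rho u A (b :: B) -> exists u', absorbs rho u' A B.
Proof.
set sigma := rotate rho u => rho_conf trans abs.
have avoid v : eventually_avoids sigma b v by exact/finite_visit_timesP.
have [T TP] := choice avoid.
exists (fun v => u v + odometer sigma b (T v) v) => v.
pose t := maxn (T v) (\max_(w <- m v) T w).
have tv : T v <= t by rewrite leq_maxl.
have stat w : T w <= t -> odometer sigma b (T w) w = odometer sigma b t w.
  by move=> Tt; rewrite (odometer_stationary _ _ _ _ _ (TP w) Tt).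
have := absorbs_move rho u A B b t rho_conf abs v.
rewrite /= -/sigma; case: eqP => [/(TP v t tv)//|_].
rewrite stat // add0n (eq_inflow _ _ (fun w => u w + odometer sigma b (T w) w)) //.
move=> w wv; rewrite stat // leq_max orbC.
by rewrite (leq_bigmax_seq (P := xpredT) (F := T) w wv).
Qed.

Lemma absorbs_cancel rho u A B y :
  graph_connected e -> rotor_configuration e rho ->
  size B <= size A -> absorbs rho u (y :: A) B ->
  exists u', absorbs rho u' [:: y] [::].
Proof.
move=> e_conn rho_conf; elim: B A u => [|b B IHB] A u.
  (* Dropping the leftover chips only weakens the inequality. *)
  by move=> _ abs; exists u => v; have := abs v; rewrite /=; lia.
move=> szBA abs.
have [rec|trans] := recurrent_or_transient_walk _ b e_conn
    (rotor_configuration_rotate rho u rho_conf); last first.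
  have [u' abs'] := absorbs_escape _ _ _ _ _ rho_conf trans abs.
  by apply: IHB abs'; apply: ltnW.
case: A szBA abs => // a A; rewrite ltnS => szBA abs.
have [t ta] : exists t, rotor_walk m (rotate rho u) b t = a.
  apply: contrapT => none; apply: (rec a); apply/finite_visit_timesP.
  by exists 0 => t _ ta; apply: none; exists t.
have := absorbs_move _ _ _ _ _ t rho_conf abs; rewrite ta => abs'.
by apply: (IHB A (fun w => u w + odometer (rotate rho u) b t w) szBA) => v; have := abs' v; rewrite /=; lia.
Qed.

(* Trading the exits of [rho] for those of [rho'] on a finite set changes
   chips and holes equally in number. *)
Lemma absorbs_change_config rho rho' u A B (F : seq V) :
  rotor_configuration e rho -> rotor_configuration e rho' ->
  uniq F -> {in [predC F], rho =1 rho'} -> absorbs rho u A B ->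
  exists2 AB, size AB.1 = size AB.2 &
    absorbs rho' u (AB.1 ++ A) (AB.2 ++ B).
Proof.
move=> rho_conf rho'_conf UF eqF abs.
pose E r := flatten [seq exits r w (u w) | w <- F].
(* Targets reached from [F] under [rho] become chips and those under [rho'] holes; each [w] in [F]
   contributes [u w] of either. *)
exists (E rho, E rho').
  rewrite !size_flatten /shape -!map_comp; congr sumn; apply: eq_map => w /=.
  by rewrite !size_traject.
move=> v; have := abs v; rewrite !count_cat /=.
have countE r : rotor_configuration e r ->
    count_mem v (E r) = \sum_(w <- m v | w \in F) count_mem v (exits r w (u w)).
  move=> r_conf; rewrite count_flatten -map_comp sumnE big_map.
  rewrite (bigID (mem (m v))) /= [X in _ + X]big1 ?addn0; last first.
    by move=> w; apply: exits_nonadjacent.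
  rewrite -big_filter -[RHS]big_filter; apply: perm_big.
  apply: uniq_perm; rewrite ?filter_uniq // => w.
  by rewrite !mem_filter andbC.
rewrite !countE // /inflow (bigID (mem F)) /= [X in _ -> _ + X <= _](bigID (mem F)) /=.
have -> : \sum_(w <- m v | w \notin F) count_mem v (exits rho w (u w)) =
          \sum_(w <- m v | w \notin F) count_mem v (exits rho' w (u w)).
  by apply: eq_bigr => w wF; rewrite /exits eqF.
lia.
Qed.

(** * Transience under finite changes *)

Lemma transient_walk_change rho rho' x y :
  graph_connected e ->
  rotor_configuration e rho -> rotor_configuration e rho' ->
  finite_set [set v | rho v != rho' v]%classic ->
  transient_walk m rho x -> transient_walk m rho' y.
Proof.
move=> e_conn rho_conf rho'_conf /finite_seqP[F FE] trans.
(* A chip and a hole at [x] balance without any firing; the hole then escapes along the transient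
   walk. *)
have start : absorbs rho (fun=> 0) [:: x] [:: x].
  move=> v; rewrite /inflow big1 ?addn0 //.
have [u abs] := absorbs_escape rho (fun=> 0) _ _ x rho_conf trans start.
have [||[A B] /= szAB abs'] := absorbs_change_config _ _ _ _ _ (undup F)
  rho_conf rho'_conf _ _ abs; first exact: undup_uniq.
  move=> v; rewrite !inE mem_undup => vF; apply/eqP/negPn/negP => neq.
  have : [set` F]%classic v by rewrite -FE.
  by move=> /= vF'; rewrite vF' in vF.
(* A chip and a hole are created at [y]; the chip at [x] makes up for the new hole in the count. *)
have abs'' : absorbs rho' u (y :: A ++ [:: x]) (y :: B).
  by move=> v; have := abs' v; rewrite cats0 /=; lia.
have szB : size (y :: B) <= size (A ++ [:: x]) by rewrite size_cat /= szAB addn1.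
have [u' abs_y] := absorbs_cancel _ _ _ _ _ e_conn rho'_conf szB abs''.
exact: absorbs_transient rho'_conf abs_y.
Qed.

End RotorWalk.

Local Open Scope classical_set_scope.

Theorem corollary6 (V : eqType) (e : rel V)
  (e_irrefl : irreflexive e) (e_sym : symmetric e)
  (V_infinite : infinite_set [set: V])
  (e_connected : graph_connected e) (e_locally_finite : locally_finite e)
  (m : V -> seq V) (m_mech : rotor_mechanism e m)
  (rho rho' : V -> V)
  (rho_conf : rotor_configuration e rho)
  (rho'_conf : rotor_configuration e rho')
  (finite_diff : finite_set [set v | rho v != rho' v]) :
  (recurrent_configuration m rho /\ recurrent_configuration m rho') \/
  (transient_configuration m rho /\ transient_configuration m rho').
Proof.
(* Comparing a configuration with itself changes only the starting vertex. *)
have finite_refl (r : V -> V) : finite_set [set v | r v != r v].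
  by apply: (sub_finite_set _ (finite_set0 V)) => v /=; rewrite eqxx.
have finite_sym : finite_set [set v | rho' v != rho v].
  by apply: (sub_finite_set _ finite_diff) => v /=; rewrite eq_sym.
have change := transient_walk_change V e m e_sym m_mech.
(* One transient walk for [rho] makes all walks for both transient. If there is none, a transient
   walk for [rho'] would produce one. *)
have [[x trans]|none] := EM (exists x, transient_walk m rho x).
  by right; split=> y; [apply: (change rho rho x) | apply: (change rho rho' x)].
left; split=> x.
  have [//|trans] := recurrent_or_transient_walk V e m e_sym m_mech rho x e_connected rho_conf.
  by case: none; exists x.
have [//|trans] := recurrent_or_transient_walk V e m e_sym m_mech rho' x e_connected rho'_conf.
by case: none; exists x; apply: (change rho' rho x).
Qed.
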